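(* Let $\mathbb{K}$ be a field, let $d,m,n\in \mathbb{N}$ with $0< d <\min\{m,n\}$, let $\alpha,\beta\in \mathbb{K}$, and set $c=m+n-2d-1$. Then $$\operatorname{PSres}_d\big((x-\alpha)^m,(x-\beta)^n\big)=(\alpha-\beta)^{(m-d)(n-d)}\,\prod_{i=1}^{d}\frac{(i-1)!\,(c+i)!}{(m-i)!\,(n-i)!}.$$ In particular, if $\alpha\ne \beta$ and $\operatorname{char}(\mathbb{K})=0$ or $\operatorname{char}(\mathbb{K}) \geq m+n-d$, then $$\deg \left(\operatorname{Sres}_d\big((x-\alpha)^m,(x-\beta)^n\big) \right)=d.$$
   Context: Subresultants. Let $f=f_mx^m+\cdots+f_0$ and $g=g_nx^n+\cdots+g_0$ be polynomials in $\mathbb{K}[x]$ with $f_m\ne 0$, $g_n\neq 0$, and let $0\le d<\min\{m,n\}$. Set $f_\ell=0$ for $\ell<0$ or $\ell>m$, and $g_\ell=0$ for $\ell<0$ or $\ell>n$. The order-$d$ subresultant $\operatorname{Sres}_d(f,g)\in\mathbb{K}[x]$ is the determinant of the following $(m+n-2d)\times(m+n-2d)$ matrix. For $1\le i\le n-d$, row $i$ has entry $f_{m+i-k}$ in column $k$ for $1\le k\le m+n-2d-1$, and entry $x^{n-d-i}f$ in the last column. For $1\le i\le m-d$, row $(n-d)+i$ has entry $g_{n+i-k}$ in column $k$ for $1\le k\le m+n-2d-1$, and entry $x^{m-d-i}g$ in the last column. It is a polynomial of degree at most $d$. The $d$-th principal subresultant $\operatorname{PSres}_d(f,g)\in\mathbb{K}$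 is the coefficient of $x^d$ in $\operatorname{Sres}_d(f,g)$. The product $\prod_{i=1}^{d}\frac{(i-1)!\,(c+i)!}{(m-i)!\,(n-i)!}$ is computed in $\mathbb{Q}$; it is an integer, and is regarded as an element of $\mathbb{K}$ via the natural ring homomorphism $\mathbb{Z}\to\mathbb{K}$. *)

(* Defs.v *)
From mathcomp Require Import all_boot all_order all_algebra.

Set Implicit Arguments.
Unset Strict Implicit.
Unset Printing Implicit Defensive.

Import GRing.Theory.
Local Open Scope ring_scope.

Section Subresultants.

Variable K : fieldType.
Implicit Types f g : {poly K}.

(* Rows and columns are numbered from 0, so entry (i, k) here is entry        *)
(* (i + 1, k + 1) of the usual 1-based description: the coefficient index     *)
(* deg f + i - k is unchanged, and the exponent r - (i + 1) decreases to 0.   *)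
(* The test k <= deg f + i stands for the convention that coefficients with   *)
(* a negative index vanish (natural subtraction would truncate to index 0).   *)
Definition subres_rows (r N : nat) f : 'M[{poly K}]_(r, N) :=
  let deg_f := (size f).-1 in
  \matrix_(i < r, k < N)
    if k.+1 == N then 'X^(r - i.+1) * f
    else if (k <= deg_f + i)%N then (f`_(deg_f + i - k))%:P else 0.

(* Meaningful for nonzero f and g with d < min (deg f) (deg g); the matrix    *)
(* then has (deg g - d) + (deg f - d) = deg f + deg g - 2 d rows.             *)
Definition Sres (d : nat) f g : {poly K} :=
  let m := (size f).-1 in
  let n := (size g).-1 in
  let N := ((n - d) + (m - d))%N in
  \det (col_mx (subres_rows (n - d) N f) (subres_rows (m - d) N g)).

Definition PSres (d : nat) f g : K := (Sres d f g)`_d.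

End Subresultants.

(* Main.v *)
Require Import Defs.
From mathcomp Require Import all_boot all_order all_algebra.
From mathcomp Require Import zify ring.

Set Implicit Arguments.
Unset Strict Implicit.
Unset Printing Implicit Defensive.

Import GRing.Theory Num.Theory.
Local Open Scope ring_scope.

(** In the matrix of the order-[d] subresultant all columns but the last hold the
coefficients of the row polynomials [x^i f] and [x^j g] in the degrees above
[d].  Expanding along the last column, the coefficient of [x^e] in the
determinant is therefore the determinant of the scalar matrix whose last column
holds the coefficients of degree [e] ([coef_detp]).  For [e > d] this matrix has
two equal columns or a zero column, whence the bound on the degree
([size_detp]); for [e = d] it is the matrix [PSres_mx] of the coefficients of
all degrees at least [d].

The determinant of [PSres_mx] does not change when [x + a] is substituted for
[x] in [f] and [g] ([det_PSres_mx_comp]): up to the choice of bases it is that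
of the map sending [(u, v)] to [u f + v g] modulo the polynomials of degree less
than [d], and translation acts unitriangularly on all spaces involved.  So
[f = (x - alpha)^m] may be replaced by [x^m], whose rows start with an identity
block, and [g = (x - beta)^n] by [(x + alpha - beta)^n].  There remains a Toeplitz
determinant of size [m - d] with the entries
[C(n, d + i - k) (alpha - beta)^(n - d - i + k)]; rescaling rows and columns
extracts the power of [alpha - beta] ([det_coef_XaddC_exp]).

By the Vandermonde convolution, a unitriangular column operation turns
[C(n, d + i - k)] into [C(n + k, d + i)] ([det_toeplitz_bin]).  The latter equals
[C(n - d + k, i)] up to factors depending only on [i] or only on [k], and
[C(n - d + k, i)] has determinant 1, by the same column operation read backwards
with [d = 0].  This evaluates the integer determinant as a quotient of products
of factorials ([det_toeplitz_bin_fact]), which superfactorials identify with the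
product in the theorem ([prod_fact_det_toeplitz_bin]).  When the factorials of
all [k < m + n - d] are nonzero in the field, so is the determinant, and the
degree of the subresultant is exactly [d]. *)

Lemma det_upper_unitriangular (R : comNzRingType) r (A : 'M[R]_r) :
  (forall i j : 'I_r, (j < i)%N -> A i j = 0) -> (forall i, A i i = 1) ->
  \det A = 1.
Proof.
move=> A0 A1; rewrite -det_tr det_trig.
  by rewrite big1 // => i _; rewrite mxE A1.
by apply/is_trig_mxP => i j ij; rewrite mxE A0.
Qed.

(** * Subresultants as scalar determinants *)

Section CoefficientMatrices.

Variable K : fieldType.
Implicit Types (f g p : {poly K}) (d r s t N : nat).

(** The [N] coefficients of degree at least [d] of polynomials of degree less than
[d + N], by decreasing degree. *)
Definition coef_mx d N q (h : 'cV[{poly K}]_q) : 'M[K]_(q, N) :=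
  \matrix_(i, k) (h i 0)`_(d + N - k.+1).

Definition shifts r f : 'cV[{poly K}]_r := \col_(i < r) ('X^(r - i.+1) * f).

Definition PSres_mx d r s f g : 'M[K]_(r + s) :=
  coef_mx d (r + s) (col_mx (shifts r f) (shifts s g)).

Lemma coef_mx_col d N q1 q2 (h1 : 'cV[{poly K}]_q1) (h2 : 'cV_q2) :
  coef_mx d N (col_mx h1 h2) = col_mx (coef_mx d N h1) (coef_mx d N h2).
Proof.
by apply/matrixP=> i k; rewrite !mxE; case: (split i) => j; rewrite !mxE.
Qed.

(** The shape of the matrices that define subresultants, for arbitrary row
polynomials. *)
Definition detp_mx d N (h : 'cV[{poly K}]_N) : 'M[{poly K}]_N :=
  \matrix_(i, k) if k.+1 == N then h i 0 else (coef_mx d N h i k)%:P.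

Definition detp_coef_mx d e N (h : 'cV[{poly K}]_N) : 'M[K]_N :=
  \matrix_(i, k) if k.+1 == N then (h i 0)`_e else coef_mx d N h i k.

(** The cofactors along the last column only involve scalar columns, so the
expansion of the determinant along that column can be read degree by degree. *)
Lemma coef_detp d e N (h : 'cV[{poly K}]_N) : (0 < N)%N ->
  (\det (detp_mx d h))`_e = \det (detp_coef_mx d e h).
Proof.
case: N h => // N h _.
rewrite (expand_det_col _ ord_max) (expand_det_col _ ord_max) coef_sum.
apply: eq_bigr => i _.
have -> : cofactor (detp_mx d h) i ord_max
        = (cofactor (detp_coef_mx d e h) i ord_max)%:P.
  rewrite /cofactor rmorphM rmorphXn rmorphN1; congr (_ * _).
  rewrite -det_map_mx; congr (\det _); apply/matrixP => a b.
  rewrite !mxE eqSS eqn_leq [X in _ && X]leqNgt.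
  by rewrite lift_max ltn_ord andbF.
by rewrite coefMC !mxE eqxx.
Qed.

(** In a degree [e > d] the last column either repeats the column that already
holds the coefficients of degree [e], or vanishes since [e] exceeds all degrees. *)
Lemma size_detp d N (h : 'cV[{poly K}]_N) : (0 < N)%N ->
  (forall i, (size (h i 0%R) <= d + N)%N) -> (size (\det (detp_mx d h)) <= d.+1)%N.
Proof.
move=> N0 hs; apply/leq_sizeP => e de; rewrite coef_detp //.
have lN : (N.-1 < N)%N by lia.
(* The column of degree e is the one of index d + N - e - 1. *)
have [eN|eN] := ltnP e (d + N).
  have kN : (d + N - e.+1 < N)%N by lia.
  rewrite -det_tr; apply: (@determinant_alternate _ _ _ (Ordinal kN) (Ordinal lN)).
    by rewrite -val_eqE /=; lia.
  move=> j; rewrite !mxE /=.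
  have -> : ((d + N - e.+1).+1 == N) = false by lia.
  have -> : (N.-1.+1 == N) by lia.
  by congr (_`_ _); lia.
rewrite (expand_det_col _ (Ordinal lN)) big1 // => i _.
rewrite mxE /= (_ : (N.-1.+1 == N)); last by lia.
by rewrite nth_default ?mul0r // (leq_trans (hs i)).
Qed.

(** The last column of [coef_mx] is the one of degree [d]. *)
Lemma detp_coef_mx_d d N (h : 'cV[{poly K}]_N) : detp_coef_mx d d h = coef_mx d N h.
Proof.
apply/matrixP=> i k; rewrite !mxE; case: eqP => // kN.
by congr (_`_ _); lia.
Qed.

Lemma subres_rows_detp d r N f (i : 'I_r) (k : 'I_N) :
  ((size f).-1 + r = d + N)%N ->
  subres_rows r N f i k =
    if k.+1 == N then shifts r f i 0 else (coef_mx d N (shifts r f) i k)%:P.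
Proof.
move=> rN; rewrite !mxE; case: eqP => // kN; rewrite coefXnM.
have ir := ltn_ord i; have kltN := ltn_ord k.
have [ki|ki] := leqP k ((size f).-1 + i); last by rewrite ifT ?polyC0 //; lia.
by rewrite ifF; [congr (_`_ _)%:P; lia | lia].
Qed.

Lemma Sres_detp d f g :
  (d < (size f).-1)%N -> (d < (size g).-1)%N ->
  Sres d f g = \det (detp_mx d
    (col_mx (shifts ((size g).-1 - d) f) (shifts ((size f).-1 - d) g))).
Proof.
move=> df dg; congr (\det _); apply/matrixP => i k.
rewrite [LHS]mxE [RHS]mxE coef_mx_col [col_mx _ _ i 0]mxE [X in X%:P]mxE.
by case: (split i) => j; rewrite (@subres_rows_detp d) //; lia.
Qed.

Lemma size_shifts r f i : (size (shifts r f i 0%R) <= (size f).-1 + r)%N.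
Proof.
rewrite mxE; have ir := ltn_ord i.
have [->|f0] := eqVneq f 0; first by rewrite mulr0 size_poly0.
rewrite mulrC size_mulXn //.
have := f0; rewrite -size_poly_gt0; lia.
Qed.

Lemma size_Sres d f g :
  (d < (size f).-1)%N -> (d < (size g).-1)%N -> (size (Sres d f g) <= d.+1)%N.
Proof.
move=> df dg; rewrite Sres_detp //; apply: size_detp; first by lia.
move=> i; rewrite mxE; case: (split i) => j;
  by apply: leq_trans (size_shifts _ _) _; lia.
Qed.

Lemma PSres_det d f g :
  (d < (size f).-1)%N -> (d < (size g).-1)%N ->
  PSres d f g = \det (PSres_mx d ((size g).-1 - d) ((size f).-1 - d) f g).
Proof.
move=> df dg; rewrite /PSres Sres_detp // coef_detp; last by lia.
by rewrite detp_coef_mx_d.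
Qed.

(** * Invariance under translation *)

(** The matrix of [p(x) |-> p(x + a)] on polynomials of degree less than [d + N]
modulo those of degree less than [d]. *)
Definition translation_mx d N (a : K) : 'M[K]_N :=
  \matrix_(i, k) (('X + a%:P) ^+ (d + N - i.+1))`_(d + N - k.+1).

Lemma size_XaddC_exp (a : K) e : size (('X + a%:P) ^+ e) = e.+1.
Proof. by rewrite -[a]opprK polyCN size_exp_XsubC. Qed.

Lemma monic_XaddC_exp (a : K) e : ('X + a%:P) ^+ e \is monic.
Proof. by rewrite -[a]opprK polyCN monic_exp ?monicXsubC. Qed.

Lemma det_translation_mx d N (a : K) : \det (translation_mx d N a) = 1.
Proof.
apply: det_upper_unitriangular => [i j ji|i].
  by rewrite mxE nth_default // size_XaddC_exp; have := ltn_ord i; lia.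
rewrite mxE; have /monicP := monic_XaddC_exp a (d + N - i.+1).
by rewrite lead_coefE size_XaddC_exp.
Qed.

(** Translation does not raise the degree, so the coefficients of degree less than
[d] do not contribute to those of degree at least [d]. *)
Lemma coef_mx_comp d N q (h : 'cV[{poly K}]_q) (a : K) :
  (forall i, (size (h i 0%R) <= d + N)%N) ->
  coef_mx d N (map_mx (comp_poly ('X + a%:P)) h) = coef_mx d N h *m translation_mx d N a.
Proof.
move=> hs; apply/matrixP=> i k; rewrite !mxE comp_polyE.
rewrite (big_ord_widen _ (fun l => (h i 0)`_l *: ('X + a%:P) ^+ l) (hs i)).
rewrite big_mkcond /= coef_sum big_split_ord /= big1 ?add0r => [|l _].
  rewrite (reindex_inj rev_ord_inj) /=; apply: eq_bigr => l _; rewrite !mxE.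
  rewrite addnBA //; case: ltnP => ls; first by rewrite coefZ.
  by rewrite [X in X * _]nth_default // mul0r coef0.
case: ifP => _; last by rewrite coef0.
rewrite coefZ [X in _ * X]nth_default ?mulr0 // size_XaddC_exp.
by have := ltn_ord l; have := ltn_ord k; lia.
Qed.

(** Translating [x^j f] yields [(x + a)^j f(x + a)], and the powers of [x + a] are
unitriangular combinations of those of [x]. *)
Lemma coef_mx_shifts_comp d N r f (a : K) :
  coef_mx d N (map_mx (comp_poly ('X + a%:P)) (shifts r f)) =
  translation_mx 0 r a *m coef_mx d N (shifts r (f \Po ('X + a%:P))).
Proof.
apply/matrixP=> i k; rewrite !mxE comp_polyM comp_Xn_poly.
have {1}-> : ('X + a%:P) ^+ (r - i.+1) =
    \poly_(l < r) (('X + a%:P) ^+ (r - i.+1))`_l.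
  apply/polyP=> l; rewrite coef_poly; case: ltnP => // rl.
  by rewrite nth_default // size_XaddC_exp; have := ltn_ord i; lia.
rewrite poly_def mulr_suml coef_sum (reindex_inj rev_ord_inj) /=.
by apply: eq_bigr => l _; rewrite !mxE add0n -scalerAl coefZ.
Qed.

(** The previous two lemmas express the translated rows once as a column operation
and once as a blockwise row operation, both of determinant 1. *)
Lemma det_PSres_mx_comp d r s f g (a : K) :
  (size f <= (d + s).+1)%N -> (size g <= (d + r).+1)%N ->
  \det (PSres_mx d r s (f \Po ('X + a%:P)) (g \Po ('X + a%:P))) =
  \det (PSres_mx d r s f g).
Proof.
move=> sf sg.
pose U := block_mx (translation_mx 0 r a) 0 0 (translation_mx 0 s a).
have detU : \det U = 1 by rewrite det_ublock !det_translation_mx mulr1.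
rewrite -[LHS]mul1r -detU -[RHS]mulr1 -(det_translation_mx d (r + s) a) -!det_mulmx.
congr (\det _); rewrite /PSres_mx -coef_mx_comp.
  rewrite map_col_mx !coef_mx_col /U mul_block_col !mul0mx addr0 add0r.
  by rewrite -!coef_mx_shifts_comp.
move=> i; rewrite mxE; case: (split i) => j;
  by apply: leq_trans (size_shifts _ _) _; lia.
Qed.

(** The rows [x^j x^(d + s)] contribute the block [(1 0)], so that only the lower
right block remains. *)
Lemma det_PSres_mx_Xn d r s g :
  \det (PSres_mx d r s 'X^(d + s) g) =
  \det (\matrix_(i < s, k < s) ('X^(s - i.+1) * g)`_(d + s - k.+1)).
Proof.
rewrite /PSres_mx coef_mx_col -[X in col_mx X _]hsubmxK.
rewrite -[X in col_mx _ X]hsubmxK -/(block_mx _ _ _ _).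
have -> : lsubmx (coef_mx d (r + s) (shifts r 'X^(d + s))) = 1%:M.
  apply/matrixP=> i k; rewrite !mxE -exprD coefXn -val_eqE /=.
  by congr (_%:R); have := ltn_ord i; have := ltn_ord k; lia.
have -> : rsubmx (coef_mx d (r + s) (shifts r 'X^(d + s))) = 0.
  apply/matrixP=> i k; rewrite !mxE -exprD coefXn /=.
  by rewrite (_ : _ == _ = false) //; have := ltn_ord i; have := ltn_ord k; lia.
rewrite det_lblock det1 mul1r; congr (\det _); apply/matrixP=> i k.
by rewrite !mxE; congr (_`_ _) => /=; have := ltn_ord k; lia.
Qed.

End CoefficientMatrices.

(** * A determinant of binomial coefficients *)

(** [C(n, e - k)], with the convention that it vanishes for a negative lower index,
where truncated subtraction would give 1. *)
Definition shifted_bin n e k := if (k <= e)%N then 'C(n, e - k) else 0%N.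

(** The Vandermonde convolution, with a range of summation that is independent of
[e] and [i], so that it reads as an entry of a matrix product. *)
Lemma Vandermonde_shifted n i e s : (i < s)%N ->
  (\sum_(k < s) 'C(i, k) * shifted_bin n e k = 'C(n + i, e))%N.
Proof.
move=> si; pose G k := ('C(i, k) * shifted_bin n e k)%N.
rewrite -(big_mkord xpredT G) addnC -binomial.Vandermonde.
rewrite (eq_bigr (fun k : 'I_e.+1 => G k)); last first.
  by move=> k _; rewrite /G /shifted_bin -ltnS ltn_ord.
rewrite -(big_mkord xpredT G).
(* Both sums extend to a common range on which the extra terms vanish. *)
have H t : (t <= s + e.+1)%N -> (forall k, (t <= k)%N -> G k = 0%N) ->
    (\sum_(0 <= k < t) G k = \sum_(0 <= k < s + e.+1) G k)%N.
  move=> ts G0; rewrite (@big_cat_nat _ _ _ t 0 (s + e.+1)) //=.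
  by rewrite [X in (_ = _ + X)%N]big_nat_cond [X in (_ = _ + X)%N]big1 ?addn0 // => k /andP[/andP[/G0]].
rewrite (H s) ?leq_addr //; last by move=> k sk; rewrite /G bin_small // (leq_trans si).
rewrite (H e.+1) ?leq_addl // => k ek.
by rewrite /G /shifted_bin leqNgt ek muln0.
Qed.

Definition toeplitz_bin n d s : 'M[int]_s :=
  \matrix_(i, k) (shifted_bin n (d + i) k)%:R.

Lemma det_toeplitz_bin n d s :
  \det (toeplitz_bin n d s) = \det (\matrix_(i < s, k < s) 'C(n + k, d + i)%:R : 'M[int]_s).
Proof.
pose L : 'M[int]_s := \matrix_(k, j) 'C(j, k)%:R.
have detL : \det L = 1.
  apply: det_upper_unitriangular => [i j ji|i]; rewrite mxE ?binn //.
  by rewrite bin_small.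
rewrite -[LHS]mulr1 -[X in _ * X]detL -det_mulmx; congr (\det _); apply/matrixP=> i j.
rewrite !mxE -(Vandermonde_shifted _ _ (ltn_ord j)) natr_sum.
by apply: eq_bigr => k _; rewrite !mxE -natrM mulnC.
Qed.

(** Undoing the column operation of [det_toeplitz_bin] with [d = 0] leaves the
lower unitriangular matrix [C(n, i - k)]. *)
Lemma det_bin_unit n s : \det (\matrix_(i < s, k < s) 'C(n + k, i)%:R : 'M[int]_s) = 1.
Proof.
rewrite -(det_toeplitz_bin n 0) -det_tr.
apply: det_upper_unitriangular => [i j ji|i]; rewrite !mxE /shifted_bin add0n.
  by rewrite leqNgt ji.
by rewrite leqnn subnn bin0.
Qed.

Lemma bin_shift_fact n d i j : (d <= n)%N ->
  ('C(n + j, d + i) * (d + i)`! * (n - d + j)`! = (n + j)`! * i`! * 'C(n - d + j, i))%N.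
Proof.
move=> dn; have [ij|ji] := leqP i (n - d + j); last by rewrite !bin_small; lia.
have le : (d + i <= n + j)%N by lia.
have eq : (n - d + j - i = n + j - (d + i))%N by lia.
rewrite -(bin_fact ij) -(bin_fact le) eq; lia.
Qed.

(** Each entry of [C(n + k, d + i)] is that of [C(n - d + k, i)], a matrix of
determinant 1, multiplied by a row factor and a column factor
([bin_shift_fact]). *)
Lemma det_toeplitz_bin_fact n d s : (d <= n)%N ->
  \det (toeplitz_bin n d s) * (\prod_(i < s) ((d + i)`! * (n - d + i)`!))%:R =
  (\prod_(i < s) ((n + i)`! * i`!))%:R.
Proof.
move=> dn; pose D (u : nat -> nat) : 'M[int]_s := diag_mx (\row_i (u i)%:R).
have detD u : \det (D u) = (\prod_(i < s) u i)%:R.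
  by rewrite det_diag natr_prod; apply: eq_bigr => i _; rewrite mxE.
set B := \matrix_(i < s, k < s) 'C(n + k, d + i)%:R : 'M[int]_s.
set C := \matrix_(i < s, k < s) 'C(n - d + k, i)%:R : 'M[int]_s.
have E : D (fun i => (d + i)`!)%N *m B *m D (fun i => (n - d + i)`!)%N =
    D (fun i => i`!) *m C *m D (fun i => (n + i)`!)%N.
  apply/matrixP=> i j; rewrite !mul_mx_diag !mul_diag_mx !mxE.
  by rewrite -!natrM; congr (_%:R); have := bin_shift_fact i j dn; lia.
have := congr1 determinant E; rewrite !det_mulmx !detD det_bin_unit mulr1.
rewrite det_toeplitz_bin -/B !big_split /= !natrM => E'.
by rewrite mulrA [X in X * _]mulrC E' mulrC.
Qed.

(** * Powers of linear polynomials *)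

Lemma coef_XaddC_exp (K : fieldType) (a : K) n e :
  (('X + a%:P) ^+ n)`_e = a ^+ (n - e) *+ 'C(n, e).
Proof.
rewrite addrC exprDn coef_sum.
under eq_bigr => i _ do rewrite coefMn -polyC_exp coefCM coefXn.
have [en|ne] := leqP e n; last first.
  rewrite bin_small // mulr0n big1 // => i _; rewrite gtn_eqF ?mulr0 ?mul0rn //.
  exact: leq_ltn_trans (leq_ord i) ne.
rewrite (bigD1 (Ordinal (en : (e < n.+1)%N))) //= eqxx mulr1 big1 ?addr0 // => i.
by rewrite -val_eqE /= eq_sym => /negbTE ->; rewrite mulr0 mul0rn.
Qed.

(** For [a != 0], multiplying row [i] by [a^i] and dividing column [k] by [a^k] makes
the power of [a] in every entry equal to [a^(n - d)]. *)
Lemma det_coef_XaddC_exp (K : fieldType) (a : K) d n s : (d < n)%N -> (0 < s)%N ->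
  \det (\matrix_(i < s, k < s)
      ('X^(s - i.+1) * ('X + a%:P) ^+ n)`_(d + s - k.+1)) =
  a ^+ (s * (n - d)) * (\det (toeplitz_bin n d s))%:~R.
Proof.
move=> dn s0; set E := \matrix_(i, k) _.
have EE i k : E i k = a ^+ (n - (d + i - k)) *+ shifted_bin n (d + i) k.
  rewrite mxE coefXnM /shifted_bin coef_XaddC_exp; have := ltn_ord i; have := ltn_ord k.
  move=> ks ls; have [ki|ki] := leqP k (d + i); last by rewrite ifT //; lia.
  by rewrite ifF; [congr (a ^+ (n - _) *+ 'C(n, _)); lia | lia].
(* For a = 0 the first row vanishes, its exponents n - d + k being positive. *)
have [a0|a0] := eqVneq a 0.
  rewrite a0 expr0n muln_eq0 subn_eq0 leqNgt dn gtn_eqF // mul0r.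
  rewrite (expand_det_row _ (Ordinal s0)) big1 // => k _.
  by rewrite EE a0 expr0n (_ : (_ == 0)%N = false) ?mul0rn ?mul0r //=; lia.
pose D (u : nat -> nat) : 'M[K]_s := diag_mx (\row_i a ^+ u i).
have detD u : \det (D u) = \prod_(i < s) a ^+ u i.
  by rewrite det_diag; apply: eq_bigr => i _; rewrite mxE.
have EDT : D id *m E =
    map_mx intr (toeplitz_bin n d s) *m D (fun k => n - d + k)%N.
  apply/matrixP=> i k; rewrite mul_mx_diag mul_diag_mx [LHS]mxE [RHS]mxE EE !mxE.
  rewrite rmorph_nat -mulr_natl mulrCA -exprD.
  have [->|] := eqVneq (shifted_bin n (d + i) k) 0%N; first by rewrite !mul0r.
  rewrite /shifted_bin; case: leqP => // ki; rewrite -lt0n bin_gt0 => kn.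
  by congr (_ * a ^+ _); lia.
have := congr1 determinant EDT; rewrite !det_mulmx det_map_mx !detD.
under [X in _ = _ * X -> _]eq_bigr => i _ do rewrite exprD.
rewrite big_split /= prodr_const card_ord -exprM => H.
have a'0 : \prod_(i < s) a ^+ i != 0.
  by apply/prodf_neq0 => i _; rewrite expf_neq0.
by apply: (mulfI a'0); rewrite H [(s * _)%N]mulnC; ring.
Qed.

(** Every product of factorials at hand runs over an interval, hence is a quotient
of two superfactorials; this is what makes the two formulas comparable. *)
Definition superfact k := (\prod_(i < k) i`!)%N.

Lemma superfactD a k : (superfact a * \prod_(i < k) (a + i)`! = superfact (a + k))%N.
Proof. by rewrite /superfact big_split_ord. Qed.

Lemma prod_fact_det_toeplitz_bin (d m n : nat) :
  (d < m)%N -> (d < n)%N ->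
  \prod_(1 <= i < d.+1)
    (((i - 1)`! * (m + n - 2 * d - 1 + i)`!)%:R / ((m - i)`! * (n - i)`!)%:R : rat) =
  (\det (toeplitz_bin n d (m - d)))%:~R.
Proof.
move=> dm dn; pose sf k : rat := (superfact k)%:R.
have sf0 k : sf k != 0.
  by rewrite pnatr_eq0 -lt0n prodn_gt0 // => i; rewrite fact_gt0.
pose T a k : rat := (\prod_(i < k) (a + i)`!)%:R.
have TE a k : T a k = sf (a + k)%N / sf a.
  by rewrite /sf -superfactD natrM mulrC mulKf // -/(sf a).
(* The factors (m - i)! and (n - i)! are listed by decreasing argument. *)
have revT a : (d < a)%N -> (\prod_(i < d) (a - i.+1)`!)%:R = T (a - d)%N d.
  move=> da; rewrite (reindex_inj rev_ord_inj) /T /=; congr (_%:R).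
  by apply: eq_bigr => i _; congr (_`!); have := ltn_ord i; lia.
rewrite big_add1 /= big_mkord prodf_div -!natr_prod !big_split /= !natrM.
rewrite [X in X%:R * _ / _](eq_bigr (fun i : 'I_d => i`!)) => [|i _]; last by rewrite subn1.
rewrite [X in _ * X%:R / _](eq_bigr (fun i : 'I_d => ((m + n - 2 * d) + i)`!)) => [|i _]; last first.
  by congr (_`!); lia.
rewrite !revT // -/(T _ _) -/(superfact d) -/(sf d) !TE.
have := congr1 (intr : int -> rat) (det_toeplitz_bin_fact (m - d) (ltnW dn)).
rewrite rmorphM !rmorph_nat !big_split /= !natrM -!/(T _ _) -/(superfact _) -/(sf _) !TE.
set D := (\det _)%:~R.
rewrite !subnK ?subnKC ?(ltnW dm) ?(ltnW dn) //.
have -> : (m + n - 2 * d + d = n + (m - d))%N by lia.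
have -> : (m + n - 2 * d = n - d + (m - d))%N by lia.
move=> H.
have -> : D = sf (n + (m - d))%N / sf n * sf (m - d)%N /
    (sf m / sf d * (sf (n - d + (m - d))%N / sf (n - d)%N)).
  by rewrite -H mulfK // !mulf_neq0 ?invr_neq0.
by field; rewrite !sf0.
Qed.

Lemma PSres_powers (K : fieldType) (d m n : nat) (alpha beta : K) :
  (d < m)%N -> (d < n)%N ->
  PSres d (('X - alpha%:P) ^+ m) (('X - beta%:P) ^+ n) =
  (alpha - beta) ^+ ((m - d) * (n - d)) * (\det (toeplitz_bin n d (m - d)))%:~R.
Proof.
move=> dm dn.
rewrite PSres_det !size_exp_XsubC // -(det_PSres_mx_comp alpha) ?size_exp_XsubC; [|lia..].
rewrite !rmorphXn /= !comp_polyB comp_polyX !comp_polyC addrK.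
rewrite -addrA -polyCB (_ : 'X^m = 'X^(d + (m - d))); last by rewrite subnKC // ltnW.
rewrite det_PSres_mx_Xn det_coef_XaddC_exp //.
by rewrite subn_gt0.
Qed.

Lemma fact_neq0 (R : idomainType) N : (forall k, (0 < k < N)%N -> k%:R != 0 :> R) ->
  forall k, (k < N)%N -> k`!%:R != 0 :> R.
Proof.
move=> N0; elim=> [|k IH] kN; first by rewrite oner_neq0.
by rewrite factS natrM mulf_neq0 //; [apply: N0 | apply/IH/ltnW].
Qed.

(** The determinant divides, in the integers, a product of factorials of numbers
less than [n + s]. *)
Lemma det_toeplitz_bin_neq0 (R : idomainType) n d s : (d <= n)%N ->
  (forall k, (0 < k < n + s)%N -> k%:R != 0 :> R) ->
  (\det (toeplitz_bin n d s))%:~R != 0 :> R.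
Proof.
move=> dn N0; have := congr1 (intr : int -> R) (det_toeplitz_bin_fact s dn).
rewrite rmorphM !rmorph_nat /= => H; apply/eqP => D0; move/eqP: H.
rewrite D0 mul0r eq_sym; apply/negP; rewrite natr_prod; apply/prodf_neq0 => i _.
by have lt_is := ltn_ord i; rewrite natrM mulf_neq0 // (fact_neq0 N0) //; lia.
Qed.

Lemma natr_neq0_pchar (R : idomainType) N :
  [pchar R] =i pred0 \/ (exists2 p, p \in [pchar R] & (N <= p)%N) ->
  forall k, (0 < k < N)%N -> k%:R != 0 :> R.
Proof.
move=> charR k /andP[k0 kN]; case: charR => [/pcharf0P-> | [p pR Np]].
  by rewrite -lt0n.
rewrite -(dvdn_pcharf pR) gtnNdvd //; exact: leq_trans kN Np.
Qed.

Theorem proposition3p3 (K : fieldType) (d m n : nat) (alpha beta : K)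
    (hd0 : (0 < d)%N) (hdmn : (d < minn m n)%N) :
  let c := (m + n - 2 * d - 1)%N in
  let P : rat := \prod_(1 <= i < d.+1)
      (((i - 1)`! * (c + i)`!)%:R / ((m - i)`! * (n - i)`!)%:R) in
  let f := ('X - alpha%:P) ^+ m in
  let g := ('X - beta%:P) ^+ n in
  [/\ P \is a Num.int,
      PSres d f g
        = (alpha - beta) ^+ ((m - d) * (n - d)) * (numq P)%:~R
    & alpha != beta ->
      ([pchar K] =i pred0) \/ (exists2 p, p \in [pchar K] & (m + n - d <= p)%N) ->
      size (Sres d f g) = d.+1].
Proof.
move: hdmn; rewrite leq_min => /andP[dm dn] c P f g.
have PE : P = (\det (toeplitz_bin n d (m - d)))%:~R by exact: prod_fact_det_toeplitz_bin.
have PS := PSres_powers alpha beta dm dn.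
split; first by rewrite PE intr_int.
  by rewrite PE numq_int.
move=> ab charK; apply/anti_leq; rewrite size_Sres ?size_exp_XsubC //=.
rewrite ltnNge; apply/negP => /leq_sizeP/(_ d (leqnn d)) /eqP; apply/negP.
rewrite -/(PSres d f g) PS mulf_neq0 ?expf_neq0 ?subr_eq0 //.
apply: (det_toeplitz_bin_neq0 (ltnW dn)).
by rewrite addnBA ?(ltnW dm) // addnC; apply: natr_neq0_pchar.
Qed.
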